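(* Let $D$ be a bidirected graph and let $f: V(D) \to \mathbb{N}_0$ be a function. Then $D$ is DP-$f$-colorable if and only if its underlying undirected graph $G(D)$ is DP-$f$-colorable.
   Context: Digraphs are finite, without loops and without parallel arcs, but two opposite arcs $uv$ and $vu$ between the same pair of vertices are allowed. A bidirected graph is a digraph obtained from a simple undirected graph by replacing each edge by two opposite arcs. The underlying graph $G(D)$ of a digraph $D$ is the simple graph on $V(D)$ in which $u,v$ are adjacent iff at least one of $uv, vu$ is an arc of $D$. A cover of a digraph $D$ is a pair $(X,H)$ where $X$ assigns to each $v \in V(D)$ a set $X_v$, the sets $X_v$ being pairwise disjoint, and $H$ is a digraph with $V(H)=\bigcup_{v} X_v$ such that each $X_v$ is independent in $H$, for each arc $a=uv \in A(D)$ the arcs of $H$ from $X_u$ to $X_v$ form a (possibly empty) matching $M_a$, and $A(H)=\bigcup_{a\in A(D)} M_a$. A transversal is a set $T\subseteq V(H)$ with $|T\cap X_v|=1$ for all $v$; it is acyclic if $H[T]$ contains no directed cycle. $D$ is $(X,H)$-colorable if $(X,H)$ has an acyclic transversal, and $D$ is DP-$f$-colorable if $D$ is $(X,H)$-colorable for every cover $(X,H)$ with $|X_v|\ge f(v)$ for all $v$. For a simple undirected graph $G$, a cover $(X,H)$ is defined analogously with $H$ an undirected graph, each $X_v$ independent, for each edge $uv$ the edges of $H$ between $X_u$ and $X_v$ forming a (possibly empty) matching, and $E(H)$ the union of these matchings; $G$ is $(X,H)$-colorable if there is a transversal $T$ with $H[T]$ edgeless, and DP-$f$-colorable if it is $(X,H)$-colorable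 for every cover with $|X_v|\ge f(v)$ for all $v$. *)

(* Defs.v *)
From mathcomp Require Import all_boot.

Set Implicit Arguments.
Unset Strict Implicit.
Unset Printing Implicit Defensive.

(* Representing adjacency by a relation rules out parallel arcs (edges);
   opposite arcs are allowed in a digraph. *)
Record digraph (V : finType) := Digraph {
  arc : rel V;
  arc_irr : irreflexive arc
}.

Record sgraph (V : finType) := SGraph {
  edge : rel V;
  edge_irr : irreflexive edge;
  edge_sym : symmetric edge
}.

Section Digraphs.
Variable V : finType.
Implicit Types (D : digraph V) (A B T : {set V}).

Definition arc_set D : {set V * V} := [set a | arc D a.1 a.2].

Definition arcs_from_to D A B : {set V * V} :=
  [set a in arc_set D | (a.1 \in A) && (a.2 \in B)].

Definition arc_ends (a : V * V) : {set V} := [set a.1; a.2].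

Definition arc_matching (M : {set V * V}) : Prop :=
  forall a b, a \in M -> b \in M -> a != b ->
    [disjoint arc_ends a & arc_ends b].

Definition arc_independent D A : Prop :=
  forall x y, x \in A -> y \in A -> ~~ arc D x y.

(* Loops being excluded, every directed cycle has length at least 2; a pair of
   opposite arcs is a directed cycle of length 2. *)
Definition directed_cycle D (c : seq V) : Prop :=
  c != [::] /\ ucycle (arc D) c.

Definition acyclic D : Prop := forall c, ~ directed_cycle D c.

Definition induced_arc D T : rel {x : V | x \in T} :=
  fun x y => arc D (val x) (val y).

Lemma induced_arc_irr D T : irreflexive (@induced_arc D T).
Proof. by move=> x; apply: arc_irr. Qed.

Definition induced_digraph D T : digraph {x : V | x \in T} :=
  Digraph (@induced_arc_irr D T).

Definition bidirected D : Prop :=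
  exists G : sgraph V, forall u v, arc D u v = edge G u v.

Definition underlying_edge D : rel V := fun u v => arc D u v || arc D v u.

Lemma underlying_edge_irr D : irreflexive (underlying_edge D).
Proof. by move=> u; rewrite /underlying_edge arc_irr. Qed.

Lemma underlying_edge_sym D : symmetric (underlying_edge D).
Proof. by move=> u v; rewrite /underlying_edge orbC. Qed.

Definition underlying D : sgraph V :=
  SGraph (@underlying_edge_irr D) (@underlying_edge_sym D).

End Digraphs.

Section SGraphs.
Variable V : finType.
Implicit Types (G : sgraph V) (A B T : {set V}).

Definition edge_set G : {set {set V}} :=
  [set [set p.1; p.2] | p : V * V & edge G p.1 p.2].

Definition edges_between G A B : {set {set V}} :=
  [set [set p.1; p.2] | p in setX A B & edge G p.1 p.2].

(* Edges are sets of endpoints, so a matching is a set of pairwise disjoint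
   edges. *)
Definition edge_matching (M : {set {set V}}) : Prop := trivIset M.

Definition edge_independent G A : Prop :=
  forall x y, x \in A -> y \in A -> ~~ edge G x y.

Definition edgeless G : Prop := edge_set G = set0.

Definition induced_edge G T : rel {x : V | x \in T} :=
  fun x y => edge G (val x) (val y).

Lemma induced_edge_irr G T : irreflexive (@induced_edge G T).
Proof. by move=> x; apply: edge_irr. Qed.

Lemma induced_edge_sym G T : symmetric (@induced_edge G T).
Proof. by move=> x y; apply: edge_sym. Qed.

Definition induced_sgraph G T : sgraph {x : V | x \in T} :=
  SGraph (@induced_edge_irr G T) (@induced_edge_sym G T).

End SGraphs.

Section Covers.
Variables V W : finType.
Implicit Types (X : V -> {set W}) (T : {set W}).

(* Not [partition]: some of the sets [X v] may be empty. *)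
Definition vertex_cover_sets X : Prop :=
  (forall u v, u != v -> [disjoint X u & X v]) /\
  \bigcup_v X v = [set: W].

Definition transversal_of X T : Prop := forall v, #|T :&: X v| = 1.

Definition is_dicover (D : digraph V) X (H : digraph W) : Prop :=
  [/\ vertex_cover_sets X,
      forall v, arc_independent H (X v),
      forall u v, arc D u v -> arc_matching (arcs_from_to H (X u) (X v))
    & arc_set H = \bigcup_(a in arc_set D) arcs_from_to H (X a.1) (X a.2)].

Definition dicover_colorable X (H : digraph W) : Prop :=
  exists T : {set W}, transversal_of X T /\ acyclic (induced_digraph H T).

Definition is_cover (G : sgraph V) X (H : sgraph W) : Prop :=
  [/\ vertex_cover_sets X,
      forall v, edge_independent H (X v),
      forall u v, edge G u v -> edge_matching (edges_between H (X u) (X v))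
    & edge_set H =
        \bigcup_(p : V * V | edge G p.1 p.2) edges_between H (X p.1) (X p.2)].

Definition cover_colorable X (H : sgraph W) : Prop :=
  exists T : {set W}, transversal_of X T /\ edgeless (induced_sgraph H T).

End Covers.

Definition di_DP_colorable (V : finType) (D : digraph V) (f : V -> nat) : Prop :=
  forall (W : finType) (X : V -> {set W}) (H : digraph W),
    is_dicover D X H -> (forall v, f v <= #|X v|) -> dicover_colorable X H.

Definition DP_colorable (V : finType) (G : sgraph V) (f : V -> nat) : Prop :=
  forall (W : finType) (X : V -> {set W}) (H : sgraph W),
    is_cover G X H -> (forall v, f v <= #|X v|) -> cover_colorable X H.

(* Main.v *)
(* Only the converse direction needs an idea.  Fix a linear order on [V] and,
   in a cover of [D], keep only the arcs going up in that order, as undirected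
   edges: this is a cover of the underlying graph.  In a transversal without
   such edges all remaining arcs go strictly down, so there is no directed
   cycle. *)
From mathcomp Require Import all_boot.
(* Imported last so that [arc] is not the one of [path]. *)
Require Import Defs.

Set Implicit Arguments.
Unset Strict Implicit.
Unset Printing Implicit Defensive.

Lemma eq_set2 (T : finType) (x y x' y' : T) :
  [set x; y] = [set x'; y'] -> x = x' /\ y = y' \/ x = y' /\ y = x'.
Proof.
move=> E; have := set21 x y; have := set22 x y.
have := set21 x' y'; have := set22 x' y'.
rewrite -{1 2}E {3 4}E !inE.
by do 4![case/orP=> /eqP ?]; subst; auto.
Qed.

Section Covers.
Variables (V W : finType) (X : V -> {set W}).

Lemma mem_edge_set (G : sgraph W) x y :
  ([set x; y] \in edge_set G) = edge G x y.
Proof.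
apply/imsetP/idP => [[[x' y']]|xy]; last by exists (x, y); rewrite ?inE.
by rewrite inE /= => xy /eq_set2[] [-> ->] //; rewrite edge_sym.
Qed.

Lemma edge_setP (G : sgraph W) e :
  reflect (exists x y, e = [set x; y] /\ edge G x y) (e \in edge_set G).
Proof.
apply: (iffP imsetP) => [[[x y] xy ->]|[x [y [-> xy]]]].
  by exists x, y; rewrite inE in xy.
by exists (x, y); rewrite ?inE.
Qed.

Lemma edges_betweenP (G : sgraph W) (A B : {set W}) e :
  reflect (exists x y, [/\ e = [set x; y], x \in A, y \in B & edge G x y])
          (e \in edges_between G A B).
Proof.
apply: (iffP imsetP) => [[[x y]]|[x [y [-> xA yB xy]]]].
  by rewrite !inE /= => /andP[/andP[xA yB] xy] ->; exists x, y.
by exists (x, y); rewrite // !inE /= xA yB.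
Qed.

Lemma mem_arcs_from_to (H : digraph W) (A B : {set W}) x y :
  ((x, y) \in arcs_from_to H A B) = [&& arc H x y, x \in A & y \in B].
Proof. by rewrite !inE. Qed.

Lemma edgelessP (G : sgraph W) : edgeless G <-> forall x y, ~~ edge G x y.
Proof.
split=> [G0 x y|G0]; first by rewrite -mem_edge_set G0 inE.
apply/setP=> e; rewrite inE; apply/edge_setP => -[x [y [_]]].
exact/negP/G0.
Qed.

(** Disjoint sets that exhaust [W] are the fibres of a map to [V], some fibres possibly empty. With
    [c], membership in the cover sets becomes an equation to rewrite with. *)
Lemma vertex_cover_colouring :
  vertex_cover_sets X -> exists c : W -> V, forall x v, (x \in X v) = (c x == v).
Proof.
case=> Xdis XT.
have /fin_all_exists[c cP] : forall x, exists v, x \in X v.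
  by move=> x; have := in_setT x; rewrite -XT => /bigcupP[v _]; exists v.
exists c => x v; apply/idP/eqP => [xv|<- //].
by apply/eqP; apply: contraLR xv => /Xdis/disjointFr->.
Qed.

End Covers.

Lemma acyclic_of_decreasing (W : finType) (H : digraph W) (h : W -> nat) :
  (forall x y, arc H x y -> h y < h x) -> acyclic H.
Proof.
move=> hdec [|x p] [] // _ /andP[/= xp _].
have r_trans : transitive (fun y z => h z < h y).
  by move=> z y w zy yw; apply: ltn_trans zy.
(* The closed walk ends at its start [x], so [x] would be among the vertices with value below
   [h x]. *)
have /(order_path_min r_trans) := sub_path hdec xp.
by rewrite all_rcons ltnn.
Qed.

(** Two opposite arcs form a directed cycle of length 2. This is how acyclicity in a bidirected
    cover forces a transversal to be edgeless. *)
Lemma acyclic_asym (W : finType) (H : digraph W) x y :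
  acyclic H -> arc H x y -> ~~ arc H y x.
Proof.
move=> acH xy; apply/negP => yx; apply: (acH [:: x; y]); split=> //.
rewrite /ucycle /= xy yx inE /= andbT.
by apply: contraL xy => /eqP->; rewrite arc_irr.
Qed.

Definition bidirect (W : finType) (H : sgraph W) : digraph W :=
  Digraph (@edge_irr W H).

Lemma bidirect_dicover (V W : finType) (D : digraph V) (X : V -> {set W})
    (H : sgraph W) :
  bidirected D -> is_cover (underlying D) X H -> is_dicover D X (bidirect H).
Proof.
move=> [G DG] [Xcov Xind Xmatch HE].
have Dsym u v : arc D u v = arc D v u by rewrite !DG edge_sym.
split=> // [u v uv [x y] [x' y'] |].
  rewrite !mem_arcs_from_to => /and3P[/= xy xu yv] /and3P[/= xy' xu' yv'] neq.
  have uvE : edge (underlying D) u v by rewrite /= /underlying_edge uv.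
  have /trivIsetP := Xmatch u v uvE; apply.
  - by apply/edges_betweenP; exists x, y.
  - by apply/edges_betweenP; exists x', y'.
  (* Distinct arcs with the same ends would be opposite; then [x] and [y] both lie in [X u], which
     is independent. *)
  apply: contraNneq neq => /eq_set2[/= [-> ->] //|/= [_ yx']].
  by have := Xind u x y xu; rewrite yx' => /(_ xu'); rewrite -yx' xy.
apply/setP => -[x y]; rewrite inE /=.
apply/idP/bigcupP => [xy|[[u v] _]]; last by rewrite mem_arcs_from_to => /and3P[].
have : [set x; y] \in edge_set H by rewrite mem_edge_set.
rewrite HE => /bigcupP[[u v] /= /orP uv /edges_betweenP[x' [y' []]]].
have {}uv : arc D u v by case: uv => //; rewrite Dsym.
move=> /eq_set2[] [-> ->] xu yv xy'.
  by exists (u, v); rewrite ?mem_arcs_from_to ?inE //= xy' xu yv.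
(* Here the arc runs from [X v] to [X u], so it is assigned to the opposite arc of [D]. *)
exists (v, u); first by rewrite inE /= Dsym.
by rewrite mem_arcs_from_to /= edge_sym xy' xu yv.
Qed.

Section AscendingGraph.
Variables (W : finType) (H : digraph W) (h : W -> nat).

(** The matchings of two opposite arcs of [D] are unrelated and their union need not be a matching;
    [h] selects one of the two directions. *)
Definition ascending_edge : rel W := fun x y =>
  (h x < h y) && arc H x y || (h y < h x) && arc H y x.

Lemma ascending_edge_irr : irreflexive ascending_edge.
Proof. by move=> x; rewrite /ascending_edge ltnn. Qed.

Lemma ascending_edge_sym : symmetric ascending_edge.
Proof. by move=> x y; rewrite /ascending_edge orbC. Qed.

Definition ascending_graph : sgraph W :=
  SGraph ascending_edge_irr ascending_edge_sym.

End AscendingGraph.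

Lemma ascending_cover (V W : finType) (D : digraph V) (X : V -> {set W})
    (H : digraph W) (c : W -> V) (r : V -> nat) :
  bidirected D -> is_dicover D X H ->
  (forall x v, (x \in X v) = (c x == v)) ->
  is_cover (underlying D) X (ascending_graph H (r \o c)).
Proof.
move=> [G DG] [Xcov Xind Xmatch HE] cP.
have Dsym u v : arc D u v = arc D v u by rewrite !DG edge_sym.
have arcD x y : arc H x y -> arc D (c x) (c y).
  move=> xy; have : (x, y) \in arc_set H by rewrite inE.
  rewrite HE => /bigcupP[[u v]]; rewrite inE mem_arcs_from_to /= !cP.
  by move=> uv /and3P[_ /eqP-> /eqP->].
split=> // [v x y xv yv | u v uv |].
- by rewrite /= /ascending_edge !negb_or !negb_and !(negPf (Xind v _ _ _ _)) ?orbT.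
- have {}uv : arc D u v by case/orP: uv; rewrite // Dsym.
  apply/trivIsetP => e1 e2 /edges_betweenP[x [y [-> xu yv xy]]].
  move=> /edges_betweenP[x' [y' [-> xu' yv' xy']]] neq.
  have [cx cy cx' cy'] : [/\ c x = u, c y = v, c x' = u & c y' = v].
    by split; apply/eqP; rewrite -cP.
  move: xy xy'; rewrite /= /ascending_edge /= cx cy cx' cy'.
  (* The order of [r u] and [r v] decides which of the two arc matchings all the kept edges come
     from; a tie keeps none. *)
  case: ltngtP => //= _; rewrite ?orbF => xy xy'.
    apply: (Xmatch u v uv (x, y) (x', y')); rewrite ?mem_arcs_from_to.
    + by rewrite xy xu.
    + by rewrite xy' xu'.
    + by apply: contraNneq neq => -[-> ->].
  rewrite (setUC [set x]) (setUC [set x']).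
  have vu : arc D v u by rewrite Dsym.
  apply: (Xmatch v u vu (y, x) (y', x')); rewrite ?mem_arcs_from_to.
  + by rewrite xy yv.
  + by rewrite xy' yv'.
  + by apply: contraNneq neq => -[-> ->].
apply/setP => e; apply/edge_setP/bigcupP => [[x [y [-> xy]]]|].
  exists (c x, c y).
    by case/orP: xy => /andP[_ /arcD]; rewrite /= /underlying_edge => ->; rewrite ?orbT.
  by apply/edges_betweenP; exists x, y; rewrite !cP /=.
by case=> [[u v] _] /edges_betweenP[x [y [-> _ _ xy]]]; exists x, y.
Qed.

Theorem theorem3 (V : finType) (D : digraph V) (f : V -> nat)
  (bidirD : bidirected D) :
  di_DP_colorable D f <-> DP_colorable (underlying D) f.
Proof.
split=> colD W X H covH fX.
  have [T [TX acT]] := colD W X _ (bidirect_dicover bidirD covH) fX.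
  exists T; split=> //; apply/edgelessP => x y; apply/negP => xy.
  by have /negP[] := acyclic_asym acT xy; rewrite -[arc _ _ _]/(edge H _ _) edge_sym.
have [Xcov Xind _ _] := covH.
have [c cP] := vertex_cover_colouring Xcov.
(* An injective rank confines ties to a single set [X v]. *)
pose r (v : V) : nat := enum_rank v.
have [T [TX /edgelessP T0]] := colD W X _ (ascending_cover r bidirD covH cP) fX.
exists T; split=> //; apply: (acyclic_of_decreasing (h := fun x => r (c (val x)))).
move=> x y xy; have := T0 x y.
rewrite /= /induced_edge /= /ascending_edge /= negb_or => /andP[+ _].
(* No kept edge means that the arc does not ascend. In a tie both ends share one cover set, whose
   independence excludes the arc. *)
rewrite [arc H _ _]xy andbT -leqNgt leq_eqVlt => /orP[/eqP/ord_inj/enum_rank_inj cyx|//].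
by have := Xind (c (val x)) (val x) (val y); rewrite !cP cyx eqxx [arc _ _ _]xy => /(_ isT isT).
Qed.
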